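(* Let $(X,\rho)$ be a metric space and let $\mathcal{B}$ be a bornology on $X$ with a closed base. Then $$w(\tau_{\mathcal B})=cf(\mathcal B)\cdot 2^{<\delta(X,\mathcal B)}.$$
   Context: A bornology on a set $X$ is a family $\mathcal B$ of subsets of $X$ that is closed under taking subsets, closed under finite unions, and satisfies $\bigcup\mathcal B=X$. A base of $\mathcal B$ is a subfamily $\mathcal B_0\subset\mathcal B$ such that every $B\in\mathcal B$ is contained in some $B_0\in\mathcal B_0$; $\mathcal B$ has a closed base if it has a base consisting of closed sets (equivalently $\overline B\in\mathcal B$ for all $B\in\mathcal B$). Put $cf(\mathcal B)=\aleph_0+\min\{|\mathcal B_0|:\mathcal B_0\text{ is a base of }\mathcal B\}$. For a space $Y$, $\delta(Y)$ is $\aleph_0$ plus the least cardinal $\mathfrak m$ such that every open cover of $Y$ has a subcover of cardinality $<\mathfrak m$; $\delta(X,\mathcal B)=\sup\{\delta(\overline B):B\in\mathcal B\}$. For cardinals, $\kappa^{<\lambda}=\sup\{\kappa^{\mathfrak m}:\mathfrak m<\lambda\}$. $C(X)$ is the set of continuous functions $X\to\mathbb R$. The topology $\tau_{\mathcal B}$ on $C(X)$ is induced by the uniformity with basic entourages $[B,\epsilon]=\{(f,g):\forall x\in B,\ |f(x)-g(x)|<\epsilon\}$, where $B\in\mathcal B$, $\epsilon>0$. $w(\tau_{\mathcal B})$ is the weight of $(C(X),\tau_{\mathcal B})$. Convention: all cardinal functions are taken to be infinite, i.e. $\aleph_0$ is added to their value. *)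

(* Defs.v *)
From HB Require Import structures.
From mathcomp Require Import all_boot all_order all_algebra.
From mathcomp Require Import all_classical all_reals all_analysis.

Set Implicit Arguments.
Unset Strict Implicit.
Unset Printing Implicit Defensive.

Import Order.TTheory GRing.Theory Num.Theory.
Import numFieldNormedType.Exports.

Local Open Scope classical_set_scope.
Local Open Scope ring_scope.
Local Open Scope card_scope.
Local Open Scope relation_scope.

(* A cardinal is represented by any type of that cardinality, and equality of
   cardinals is equipotence [set: A] #= [set: B].  Thus aleph_0 + k, k * l and
   k ^ l are (nat + k)%type, (k * l)%type and (l -> k). *)

Definition cle (A B : Type) : Prop := [set: A] #<= [set: B].

Definition clt (A B : Type) : Prop := cle A B /\ ~ cle B A.

Definition is_cmin (P : Type -> Prop) (A : Type) : Prop :=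
  P A /\ forall B : Type, P B -> cle A B.

(* The default value is never used when P is satisfiable: see cminP. *)
Definition cmin (P : Type -> Prop) : Type :=
  if pselect (exists A, is_cmin P A) is left e then projT1 (cid e) else void.

Definition csup (P : Type -> Prop) : Type :=
  cmin (fun S => forall A : Type, P A -> cle A S).

(* k ^ {<l} *)
Definition cpowlt (k l : Type) : Type :=
  csup (fun A => exists2 m : Type, clt m l & A = (m -> k)).

Lemma cleP (A B : Type) : cle A B <-> exists f : A -> B, injective f.
Proof.
rewrite /cle; split.
  move=> /card_leP[f].
  exists (fun a => set_val (f (SigSub (mem_set (I : [set: A] a))))).
  move=> a a' /val_inj /(@inj _ _ _ f); rewrite !inE => /(_ I I).
  by move=> /(congr1 set_val).
move=> [f fi]; have : f @` [set: A] #<= [set: B] by exact: subset_card_le.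
apply: card_le_trans; suff /card_eqPle[] : f @` [set: A] #= [set: A] by [].
by apply: inj_card_eq => x y _ _; exact: fi.
Qed.

Lemma cle_trans (B A C : Type) : cle A B -> cle B C -> cle A C.
Proof. exact: card_le_trans. Qed.

Lemma cle_family_least (I : Type) (F : I -> Type) (i0 : I) :
  exists i, forall j, cle (F i) (F j).
Proof.
pose P (G : set (forall i, F i)) := forall i x y, G x -> G y -> x i = y i -> x = y.
have [|G [PG Gmax]] := @Zorn_bigcup _ P.
  move=> H HP Htot i x y [U HU Ux] [V HV Vy] xy.
  have [UV|VU] := Htot _ _ HU HV.
  - exact: (HP _ HV i) (UV _ Ux) Vy xy.
  - exact: (HP _ HU i) Ux (VU _ Vy) xy.
suff [i Gi] : exists i, forall t : F i, exists2 x, G x & x i = t.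
  exists i => j; apply/cleP.
  have /choice[g gP] : forall t, exists x, G x /\ x i = t.
    by move=> t; have [x] := Gi t; exists x.
  exists (fun t => g t j) => s t st.
  have [[Gs <-] [Gt <-]] := (gP s, gP t).
  by rewrite (PG j _ _ Gs Gt st).
apply: contrapT => /forallNP noti.
have yP i : {t : F i | forall x, G x -> x i <> t}.
  apply: cid; apply: contrapT => /forallNP nt; apply: (noti i) => t.
  apply: contrapT => nx; apply: (nt t) => x Gx xt; apply: nx; by exists x.
pose y i := sval (yP i).
have yN i x : G x -> x i <> y i by exact: (svalP (yP i)).
apply: (Gmax (G `|` [set y])).
  split; first by move=> x Gx; left.
  by move=> /(_ y (or_intror erefl)) Gy; exact: (yN i0 y Gy).
move=> i x z [Gx|->] [Gz|->] //; first exact: PG.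
- by move=> /(yN i x Gx).
- by move=> /esym /(yN i z Gz).
Qed.

Lemma cle_total (A B : Type) : cle A B \/ cle B A.
Proof.
have [[] h] := cle_family_least (fun b : bool => if b then A else B) true.
- by left; exact: (h false).
- by right; exact: (h true).
Qed.

Lemma range_cle (A B : Type) (f : A -> B) : injective f ->
  cle A (range f) /\ cle (range f) A.
Proof.
move=> fi; split; apply/cleP.
  have fr a : f a \in range f by rewrite inE; exists a.
  by exists (fun a => exist _ (f a) (fr a)) => a b [] /fi.
have gP (t : range f) : {a | f a = set_val t}.
  by apply: cid; have /set_mem[a _ fa] := svalP t; exists a.
exists (fun t => sval (gP t)) => s t st; apply: val_inj.
by have := svalP (gP s); rewrite st (svalP (gP t)).
Qed.

Lemma cminP (P : Type -> Prop) : (exists A, P A) -> is_cmin P (cmin P).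
Proof.
move=> [A0 PA0].
suff e : exists A, is_cmin P A.
  by rewrite /cmin; case: pselect => // e'; exact: (projT2 (cid e')).
pose Q (S : set A0) := exists B, [/\ P B, cle B S & cle S B].
have QT : Q [set: A0].
  exists A0; split => //; apply/cleP.
  - by exists (fun a => SigSub (mem_set (I : [set: A0] a))) => a b [].
  - by exists set_val; exact: val_inj.
have [[S [B [PB BS SB]]] /= Smin] :=
  cle_family_least (fun S : {S | Q S} => set_type (sval S)) (exist _ _ QT).
exists B; split=> // C PC.
have [//|CB] := cle_total B C.
have [f fi] : exists f : C -> A0, injective f.
  by apply/cleP/(cle_trans CB)/(cle_trans BS)/cleP; exists set_val; exact: val_inj.
have [Cf fC] := range_cle fi.
have QC : Q (range f) by exists C.
exact: (cle_trans BS (cle_trans (Smin (exist _ _ QC)) fC)).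
Qed.

Lemma csupP (P : Type -> Prop) (U : Type) : (forall A, P A -> cle A U) ->
  (forall A, P A -> cle A (csup P)) /\
  (forall S, (forall A, P A -> cle A S) -> cle (csup P) S).
Proof. by move=> PU; apply: cminP; exists U. Qed.

(* The empty set is required to be bounded: it is the empty finite union, and
   this only matters when T is empty. *)
Record bornology (T : Type) := Bornology {
  born : set (set T) ;
  born_sub : forall A B, A `<=` B -> born B -> born A ;
  born0 : born set0 ;
  bornU : forall A B, born A -> born B -> born (A `|` B) ;
  born_cover : \bigcup_(A in born) A = setT }.

Definition born_base (T : Type) (B : bornology T) (B0 : set (set T)) : Prop :=
  B0 `<=` born B /\ forall A, born B A -> exists2 A0, B0 A0 & A `<=` A0.

Definition has_closed_base (T : topologicalType) (B : bornology T) : Prop :=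
  exists2 B0, born_base B B0 & B0 `<=` closed.

Definition cf (T : Type) (B : bornology T) : Type :=
  (nat + cmin (fun k => exists2 B0, born_base B B0 & k = set_type B0))%type.

Definition open_cover (Y : topologicalType) (F : set (set Y)) : Prop :=
  F `<=` open /\ \bigcup_(U in F) U = setT.

Definition delta (Y : topologicalType) : Type :=
  (nat + cmin (fun m => forall F : set (set Y), open_cover F ->
     exists G : set (set Y),
       [/\ G `<=` F, \bigcup_(U in G) U = setT & clt (set_type G) m]))%type.

(* closure A, coerced to a type, carries the subspace topology. *)
Definition born_delta (T : topologicalType) (B : bornology T) : Type :=
  csup (fun d => exists2 A, born B A & d = delta (set_type (closure A))).

Definition weight (Y : topologicalType) : Type :=
  (nat + cmin (fun k => exists2 F : set (set Y), basis F & k = set_type F))%type.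

Section tau.
Context (R : realType) (X : topologicalType).

Definition Ctau (B : bornology X) : Type := continuousType X R.

Context (B : bornology X).

HB.instance Definition _ := Choice.on (Ctau B).

Definition tau_basic (A : set X) (e : R) : set (Ctau B * Ctau B) :=
  [set fg : Ctau B * Ctau B | forall x, A x -> `|fg.1 x - fg.2 x| < e].

Definition tau_entourage : set_system (Ctau B * Ctau B) :=
  filter_from [set Ae : set X * R | born B Ae.1 /\ 0 < Ae.2]
              (fun Ae => tau_basic Ae.1 Ae.2).

Let tau_filter : Filter tau_entourage.
Proof.
apply: filter_from_filter.
  by exists (set0, 1); split; [exact: born0|exact: ltr01].
move=> [A e] [A' e'] /= [BA e0] [BA' e0'].
exists (A `|` A', Num.min e e').
  by split; [exact: bornU|rewrite /= lt_min e0].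
move=> fg /= fgP; split=> x Ax; apply: lt_le_trans (fgP x _) _.
- by left.
- by rewrite ge_min lexx.
- by right.
- by rewrite ge_min lexx orbT.
Qed.

Let tau_diagonal E : tau_entourage E -> diagonal `<=` E.
Proof.
move=> [[A e] /= [BA e0] sub] [f g] /= fg; apply: sub => x _ /=.
by rewrite (fg : f = g) subrr normr0.
Qed.

Let tau_inv E : tau_entourage E -> tau_entourage E^-1.
Proof.
move=> [[A e] /= h sub]; exists (A, e) => // -[f g] fgP; apply: sub => x Ax /=.
by rewrite distrC; exact: fgP.
Qed.

Let tau_split E : tau_entourage E ->
  exists2 D, tau_entourage D & D \; D `<=` E.
Proof.
move=> [[A e] /= [BA e0] sub]; exists (tau_basic A (e / 2)).
  by exists (A, e / 2) => //; split => //=; rewrite divr_gt0.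
move=> [f g] [h /= fh hg]; apply: sub => x Ax /=.
rewrite [e]splitr (le_lt_trans (ler_distD (h x) _ _))// ltrD//.
- exact: fh.
- exact: hg.
Qed.

HB.instance Definition _ := isUniform.Build (Ctau B)
  tau_filter tau_diagonal tau_inv tau_split.

End tau.
Arguments Ctau R {X} B.

(* Main.v *)
Require Import Defs.
From mathcomp Require Import all_boot all_order all_algebra.
From mathcomp Require Import all_classical all_reals all_analysis.
From mathcomp Require Import ring lra.

(* Everything rests on the closed discrete subsets of the sets closure A, A in
   the bornology: in a metric space they all have cardinality < delta (closure A),
   and every infinite m < delta (closure A) is the size of one of them.

   Lower bound.  A local base at 0 yields a base of the bornology, hence
   cf <= w.  On a closed discrete S, every 0-1 function extends to X by Urysohn's
   lemma, and distinct ones stay 1 apart on S, hence 2^m <= w for m < delta.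

   Upper bound.  It suffices to code the continuous functions, up to uniform
   distance 3e on C = closure A, by 2^{<l} codes, where l = delta (X, B).  Let D n
   be a maximal 1/(n+1)-separated subset of C, so that |D n| < l.  If some
   infinite m < l bounds all |D n|, then C has a dense subset of size m, and the
   values of f there (up to e) are a code.  Otherwise let G n be the set of points
   of C whose 1/(n+1)-ball contains no closed discrete set of size |D n|; it has a
   dense subset of size < l.  For every f there is an n such that f oscillates
   by less than e on the 1/(n+1)-ball of every point of C outside G n: bad
   points x_n outside G n for all n would be locally finite together with their
   balls, and the union of closed discrete sets of size |D n| inside these balls
   would be a closed discrete set whose size bounds all |D n|.  So n and the values
   of f on D n and on the dense subset of G n are a code. *)

Set Implicit Arguments.
Unset Strict Implicit.
Unset Printing Implicit Defensive.

Import Order.TTheory GRing.Theory Num.Theory.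
Import numFieldNormedType.Exports.

Local Open Scope classical_set_scope.
Local Open Scope card_scope.

(** * Cardinal arithmetic *)

Lemma cle_inj (A B : Type) (f : A -> B) : injective f -> cle A B.
Proof. by move=> fi; apply/cleP; exists f. Qed.

Lemma cle_refl (A : Type) : cle A A.
Proof. exact: (@cle_inj _ _ id). Qed.

Lemma cle_surj (A B : Type) (f : B -> A) : (forall a, exists b, f b = a) -> cle A B.
Proof.
move=> /choice[g gP]; apply: (@cle_inj _ _ g) => a a' e.
by rewrite -(gP a) e gP.
Qed.

Lemma cle_set (T : Type) (S : set T) : cle S T.
Proof. by apply: (@cle_inj _ _ set_val); exact: val_inj. Qed.

Lemma cle_subset (T : Type) (S S' : set T) : S `<=` S' -> cle S S'.
Proof.
move=> sub; have h (s : S) : set_val s \in S'.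
  by rewrite inE; apply/sub/set_mem; exact: valP.
apply: (@cle_inj _ _ (fun s : S => (exist _ (set_val s) (h s) : S'))) => s s'.
by move=> /(congr1 val)/= /val_inj.
Qed.

Lemma clt_cle (A B : Type) : clt A B -> cle A B.
Proof. by case. Qed.

Lemma cleNclt (A B : Type) : ~ cle A B -> clt B A.
Proof. by move=> nAB; split=> //; have [] := cle_total A B. Qed.

Lemma cltNcle (A B : Type) : ~ clt A B -> cle B A.
Proof. by move=> nAB; apply: contrapT => /cleNclt. Qed.

Lemma clt_cle_trans (B A C : Type) : clt A B -> cle B C -> clt A C.
Proof.
move=> [AB nBA] BC; split; first exact: cle_trans BC.
by move=> CA; apply: nBA; exact: cle_trans CA.
Qed.

Lemma cle_clt_trans (B A C : Type) : cle A B -> clt B C -> clt A C.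
Proof.
move=> AB [BC nCB]; split; first exact: cle_trans BC.
by move=> CA; apply: nCB; exact: cle_trans AB.
Qed.

Lemma cle_prod (A A' B B' : Type) :
  cle A A' -> cle B B' -> cle (A * B)%type (A' * B')%type.
Proof.
move=> /cleP[f fi] /cleP[g gi].
by apply: (@cle_inj _ _ (fun x => (f x.1, g x.2))) => -[a b] [a' b'] /= [/fi-> /gi->].
Qed.

Lemma cle_pow2 (A B : Type) : cle A B -> cle (A -> bool) (B -> bool).
Proof.
move=> /cleP[f fi].
apply: (@cle_inj _ _ (fun (S : A -> bool) (b : B) => `[< exists2 a, f a = b & S a >])) => S S' e.
apply/funext => a; have /= h := congr1 (fun h => h (f a)) e.
have sub (U V : A -> bool) : `[< exists2 x, f x = f a & U x >] =
    `[< exists2 x, f x = f a & V x >] -> U a -> V a.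
  move=> UV Ua; have /asboolP : exists2 x, f x = f a & U x by exists a.
  by rewrite UV => /asboolP[x /fi->].
by apply/idP/idP; apply: sub.
Qed.

(* [G] is the graph of an injection of [D * D] into [D], where [D] is the set of
   first components of [G]. *)
Definition pairing_graph (A : Type) (G : set (A * A * A)) : Prop :=
  let D a := exists c, G (a, a, c) in
  [/\ forall a b, D a -> D b -> exists c, G (a, b, c),
      forall a b c, G (a, b, c) -> [/\ D a, D b & D c],
      forall a b c c', G (a, b, c) -> G (a, b, c') -> c = c' &
      forall a b a' b' c, G (a, b, c) -> G (a', b', c) -> (a, b) = (a', b')].

Lemma pairing_graph_of (A : Type) (D : set A) (p : A -> A -> A) :
  (forall a b, D a -> D b -> D (p a b)) ->
  (forall a b a' b', D a -> D b -> D a' -> D b' -> p a b = p a' b' ->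
     (a, b) = (a', b')) ->
  pairing_graph [set x | [/\ D x.1.1, D x.1.2 & p x.1.1 x.1.2 = x.2]].
Proof.
move=> Dp pinj; split=> /=.
- by move=> a b [c [Da _ _]] [c' [Db _ _]]; exists (p a b).
- move=> a b c [Da Db <-].
  split; [by exists (p a a)|by exists (p b b)|].
  by exists (p (p a b) (p a b)); split=> //; exact: Dp.
- by move=> a b c c' [_ _ <-] [_ _ <-].
- by move=> a b a' b' c [Da Db <-] [Da' Db' /esym/pinj]; apply.
Qed.

(** Zorn's lemma gives a maximal pairing graph, with domain [D]. If the complement of [D] injects
    into [D], then [A] injects into [bool * D], hence into [D]. Otherwise [D] has a disjoint copy in
    its complement, and the pairing extends to the union of both, against maximality. *)
Lemma infinite_prod (A : Type) : cle nat A -> cle (A * A)%type A.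
Proof.
move=> /cleP[i0 ii0].
pose G0 := [set x : A * A * A | [/\ range i0 x.1.1, range i0 x.1.2 &
   i0 (pickle (get (i0 @^-1` [set x.1.1]), get (i0 @^-1` [set x.1.2]))) = x.2]].
have i0K n : get (i0 @^-1` [set i0 n]) = n.
  by apply: ii0; apply: (@getPex _ (i0 @^-1` [set i0 n])); exists n.
have G0P : pairing_graph G0.
  apply: (@pairing_graph_of _ _ (fun a b =>
    i0 (pickle (get (i0 @^-1` [set a]), get (i0 @^-1` [set b]))))).
    by move=> a b _ _; eexists.
  move=> _ _ _ _ [a _ <-] [b _ <-] [a' _ <-] [b' _ <-]; rewrite !i0K => /ii0.
  by move=> /(pcan_inj pickleK) [-> ->].
have [|G [[GP G0G] Gmax]] :=
    @Zorn_bigcup _ (fun G => pairing_graph G /\ (G `<=>` set0 \/ G0 `<=` G)).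
  move=> F FP Ftot.
  have F2 x y : (\bigcup_(X in F) X) x -> (\bigcup_(X in F) X) y ->
      exists X, [/\ F X, X x & X y].
    move=> [X FX Xx] [Y FY Yy]; have [XY|YX] := Ftot _ _ FX FY.
    - by exists Y; split=> //; exact: XY.
    - by exists X; split=> //; exact: YX.
  split; last first.
    have [[X [FX]]|nX] := pselect (exists X, F X /\ G0 `<=` X).
      by move=> G0X; right; apply: subset_trans G0X _; exact: bigcup_sup.
    left; split=> // x [X FX Xx]; have [_ [XE|G0X]] := FP _ FX.
    - by have [+ _] := XE; apply.
    - by case: nX; exists X.
  split.
  - move=> a b [c Gc] [c' Gc']; have [X [FX Xa Xb]] := F2 _ _ Gc Gc'.
    have [[+ _ _ _] _] := FP _ FX.
    by move=> /(_ a b (ex_intro _ c Xa) (ex_intro _ c' Xb)) [d Xd]; exists d, X.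
  - move=> a b c [X FX Xabc]; have [[_ + _ _] _] := FP _ FX.
    move=> /(_ _ _ _ Xabc) [[u Xu] [v Xv] [w Xw]].
    by split; [exists u|exists v|exists w]; exists X.
  - move=> a b c c' Gc Gc'; have [X [FX Xc Xc']] := F2 _ _ Gc Gc'.
    have [[_ _ h _] _] := FP _ FX; exact: h Xc Xc'.
  - move=> a b a' b' c Gc Gc'; have [X [FX Xc Xc']] := F2 _ _ Gc Gc'.
    have [[_ _ _ h] _] := FP _ FX; exact: h Xc Xc'.
have {}G0G : G0 `<=` G.
  case: G0G => // GE; exfalso; apply: (Gmax G0).
    split; first by apply: subset_trans GE.1 _; exact: sub0set.
    move=> G0G; apply: (GE.1 (i0 0%N, i0 0%N, i0 (pickle (0%N, 0%N)))).
    by apply: G0G; rewrite /G0/= !i0K; split=> //; exists 0%N.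
  by split=> //; right.
pose D := [set a | exists c, G (a, a, c)].
have [Gtot Gdom Gfun Ginj] := GP.
have i0D n : D (i0 n).
  exists (i0 (pickle (n, n))); apply: G0G; split => /=; [by exists n|by exists n|].
  by rewrite !i0K.
have /choice[p0 p0P] (ab : A * A) : exists c, D ab.1 -> D ab.2 -> G (ab.1, ab.2, c).
  have [[Da Db]|n] := pselect (D ab.1 /\ D ab.2); last first.
    by exists (i0 0%N) => Da Db; case: n.
  by have [c Gc] := Gtot _ _ Da Db; exists c.
pose p a b := p0 (a, b).
have pP a b : D a -> D b -> G (a, b, p a b) by exact: (p0P (a, b)).
have pD a b : D a -> D b -> D (p a b) by move=> Da Db; have [] := Gdom _ _ _ (pP _ _ Da Db).
have pI a b a' b' : D a -> D b -> D a' -> D b' -> p a b = p a' b' -> (a, b) = (a', b').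
  move=> Da Db Da' Db' e; apply: Ginj (pP _ _ Da Db) _; rewrite e; exact: pP.
have DD : cle (D * D)%type D.
  have h (x : D * D) : p (set_val x.1) (set_val x.2) \in D.
    by rewrite inE; apply: pD; apply: set_mem; exact: valP.
  pose g (x : D * D) : D := exist _ (p (set_val x.1) (set_val x.2)) (h x).
  apply: (@cle_inj _ _ g) => -[a b] [a' b'].
  move=> /(congr1 val)/= /(pI _ _ _ _ (set_mem (valP a)) (set_mem (valP b))
    (set_mem (valP a')) (set_mem (valP b'))) [].
  by move=> /val_inj -> /val_inj ->.
have twoD : cle bool D.
  pose j (b : bool) : D := exist _ (i0 b) (mem_set (i0D b)).
  by apply: (@cle_inj _ _ j) => -[] [] // /(congr1 val)/= /ii0.
have [CD|/cleNclt/clt_cle/cleP[j ji]] := pselect (cle (~` D) D).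
  suff AD : cle A D.
    exact: cle_trans (cle_prod AD AD) (cle_trans DD (cle_set D)).
  apply: cle_trans DD; apply: cle_trans (cle_prod twoD (cle_refl D)).
  have /cleP[f fi] := CD.
  pose g (a : A) : bool * D := match pselect (D a) with
    | left Da => (true, exist _ a (mem_set Da))
    | right nDa => (false, f (exist _ a (mem_set nDa))) end.
  apply: (@cle_inj _ _ g) => a a'; rewrite /g.
  case: pselect => Da; case: pselect => Da' //.
  - by case.
  - by move=> [/fi []].
pose j' (a : A) : A := match pselect (D a) with
    | left Da => set_val (j (exist _ a (mem_set Da))) | right nDa => a end.
have j'I a a' : D a -> D a' -> j' a = j' a' -> a = a'.
  rewrite /j'; case: pselect => // Da _; case: pselect => // Da' _.
  by move=> /val_inj/ji [].
have j'N a : D a -> ~ D (j' a).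
  rewrite /j'; case: pselect => // Da _; exact: set_mem (valP (j _)).
pose D' := D `|` j' @` D.
(* [r] decodes a point of [D'] into a point of [D] and a flag telling whether the copy of that point
   is meant. *)
have /choice[r rP] a : exists r : A * bool, D' a ->
    D r.1 /\ a = if r.2 then j' r.1 else r.1.
  have [Da|nDa] := pselect (D a); first by exists (a, false).
  have [[b Db ba]|nb] := pselect ((j' @` D) a); first by exists (b, true).
  by exists (a, true) => -[].
pose k (b : bool) := i0 b.
have kI b b' : k b = k b' -> b = b' by move/ii0; case: b b' => -[].
have kD b : D (k b) by exact: i0D.
pose h a b := p (p (r a).1 (r b).1) (p (k (r a).2) (k (r b).2)).
have hD a b : D' a -> D' b -> D (h a b).
  by move=> /rP[Da _] /rP[Db _]; exact: pD (pD _ _ Da Db) (pD _ _ (kD _) (kD _)).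
have hI a b a' b' : D' a -> D' b -> D' a' -> D' b' -> h a b = h a' b' -> (a, b) = (a', b').
  move=> /rP[Da ea] /rP[Db eb] /rP[Da' ea'] /rP[Db' eb'].
  move=> /(pI _ _ _ _ (pD _ _ Da Db) (pD _ _ (kD _) (kD _)) (pD _ _ Da' Db')
    (pD _ _ (kD _) (kD _))) [].
  move=> /(pI _ _ _ _ Da Db Da' Db') [e1 e2].
  move=> /(pI _ _ _ _ (kD _) (kD _) (kD _) (kD _)) [/kI e3 /kI e4].
  by rewrite ea eb ea' eb' e1 e2 e3 e4.
(* [h] injects [D' * D'] into [D]. Pairs outside [D * D] are then moved by [j'] out of [D], where
   they cannot collide with values of [p]. *)
pose q a b := if `[< D a /\ D b >] then p a b else j' (h a b).
have D'P : pairing_graph [set x | [/\ D' x.1.1, D' x.1.2 & q x.1.1 x.1.2 = x.2]].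
  apply: pairing_graph_of.
    move=> a b Da Db; rewrite /q; case: asboolP => [[? ?]|_].
      by left; exact: pD.
    by right; exists (h a b) => //; exact: hD.
  move=> a b a' b' Da Db Da' Db'; rewrite /q.
  case: asboolP => [[? ?]|_]; case: asboolP => [[? ?]|_].
  - exact: pI.
  - move=> e; exfalso; apply: (j'N (h a' b')); first exact: hD.
    by rewrite -e; exact: pD.
  - move=> e; exfalso; apply: (j'N (h a b)); first exact: hD.
    by rewrite e; exact: pD.
  - by move=> /j'I/hI; apply => //; exact: hD.
have GD' : G `<=` [set x | [/\ D' x.1.1, D' x.1.2 & q x.1.1 x.1.2 = x.2]].
  move=> [[a b] c] Gc /=; have [Da Db Dc] := Gdom _ _ _ Gc.
  split; [by left|by left|]; rewrite /q; case: asboolP => [_|[]//].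
  exact: (Gfun _ _ _ _ (pP _ _ Da Db) Gc).
exfalso; apply: (Gmax _ _ (conj D'P (or_intror (subset_trans G0G GD')))).
split=> // D'G; apply: (j'N (i0 0%N) (i0D 0%N)).
have D'0 : D' (j' (i0 0%N)) by right; exists (i0 0%N).
by have [] := Gdom _ _ _ (D'G (j' (i0 0%N), j' (i0 0%N), q (j' (i0 0%N)) (j' (i0 0%N))) (And3 D'0 D'0 erefl)).
Qed.

Lemma infinite_mul (A B C : Type) : cle nat C -> cle A C -> cle B C ->
  cle (A * B)%type C.
Proof.
by move=> /infinite_prod CC AC BC; apply: cle_trans CC; exact: cle_prod.
Qed.

Lemma infinite_add (A B C : Type) : cle nat C -> cle A C -> cle B C ->
  cle (A + B)%type C.
Proof.
move=> C0 AC BC; apply: (@cle_trans (bool * C)%type); last first.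
  apply: (infinite_mul C0 _ (cle_refl C)); apply: cle_trans C0.
  by apply: (@cle_inj _ _ nat_of_bool) => -[] [].
have /cleP[f fi] := AC; have /cleP[g gi] := BC.
apply: (@cle_inj _ _ (fun x => match x with inl a => (true, f a) | inr b => (false, g b) end)).
by move=> [a|b] [a'|b'] //= []; [move/fi-> | move/gi->].
Qed.

Lemma infinite_sigma (V : nat -> Type) (C : Type) : cle nat C ->
  (forall n, cle (V n) C) -> cle {n & V n} C.
Proof.
move=> C0 VC; apply: cle_trans (infinite_mul C0 C0 (cle_refl C)).
pose f n := sval (cid ((cleP _ _).1 (VC n))).
have fi n : injective (f n) by exact: svalP (cid ((cleP _ _).1 (VC n))).
apply: (@cle_inj _ _ (fun x => (projT1 x, f _ (projT2 x)))) => -[n v] [m w] /= [e].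
by subst m => /fi ->.
Qed.

(** The largest of [nat], [A] and [B] serves; being infinite, it absorbs products. *)
Lemma clt_ub (l A B : Type) : clt nat l -> clt A l -> clt B l ->
  exists C, [/\ clt C l, cle nat C, cle A C & cle B C].
Proof.
move=> Nl Al Bl.
have [AB|BA] := cle_total A B.
  have [BN|NB] := cle_total B nat.
    by exists nat; split=> //; [exact: cle_refl|exact: cle_trans BN].
  by exists B; split=> //; exact: cle_refl.
have [AN|NA] := cle_total A nat.
  by exists nat; split=> //; [exact: cle_refl|exact: cle_trans AN].
by exists A; split=> //; exact: cle_refl.
Qed.

Lemma clt_mul (l A B : Type) : clt nat l -> clt A l -> clt B l ->
  clt (A * B)%type l.
Proof.
move=> Nl Al Bl; have [C [Cl C0 AC BC]] := clt_ub Nl Al Bl.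
exact: cle_clt_trans (infinite_mul C0 AC BC) Cl.
Qed.

Lemma cantor (A : Type) : ~ cle (A -> bool) A.
Proof.
move=> /cleP[f fi].
pose D a := `[< exists2 S : A -> bool, f S = a & ~~ S a >].
have [DD|/negP DD] := boolP (D (f D)).
- by have /asboolP[S /fi ->] := DD; rewrite DD.
- by apply/DD/asboolP; exists D => //; exact/negP.
Qed.

Lemma finite_functions_countable (I : Type) (T : countType) :
  ~ cle nat I -> cle (I -> T) nat.
Proof.
move=> nI; have /finite_seqP[s sE] : finite_set [set: {classic I}].
  by apply: contrapT => /infiniteP.
apply: (@cle_inj _ _ (fun f => pickle [seq f i | i <- s])) => f g.
move=> /(pcan_inj pickleK) /eq_in_map fg; apply/funext => i; apply: fg.
by have : [set: {classic I}] i by []; rewrite sE.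
Qed.

(** A function is coded by its graph, a subset of [I * nat]. *)
Lemma infinite_functions_countable (I : Type) (T : countType) :
  cle nat I -> cle (I -> T) (I -> bool).
Proof.
move=> I0; apply: cle_trans (cle_pow2 (infinite_mul I0 (cle_refl I) I0)).
apply: (@cle_inj _ _ (fun (f : I -> T) (x : I * nat) => pickle (f x.1) == x.2)).
move=> f g fg; apply/funext => i; apply: (pcan_inj pickleK); apply/eqP.
by have := congr1 (fun h => h (i, pickle (g i))) fg; rewrite /= eqxx.
Qed.

Lemma cpowltP (l : Type) :
  (forall m, clt m l -> cle (m -> bool) (cpowlt bool l)) /\
  (forall S, (forall m, clt m l -> cle (m -> bool) S) -> cle (cpowlt bool l) S).
Proof.
(* The bound 2^l shows that the supremum exists, so that [csup] is not a default value. *)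
have [|ub least] := @csupP (fun A => exists2 m : Type, clt m l & A = (m -> bool)) (l -> bool).
  by move=> _ [m ml ->]; apply: cle_pow2; exact: clt_cle.
split=> [m ml|S mS]; first by apply: ub; exists m.
by apply: least => _ [m ml ->]; exact: mS.
Qed.

(** Were 2^{<l} finite, it would be a cardinal m < l with 2^m <= m, against Cantor's theorem. *)
Lemma cpowlt_infinite (l : Type) : cle nat l -> cle nat (cpowlt bool l).
Proof.
move=> l0; apply: contrapT => /cleNclt S0.
have [ub _] := cpowltP l; exact: cantor (ub _ (clt_cle_trans S0 l0)).
Qed.

Lemma cpowlt_functions (I l : Type) (T : countType) : cle nat l -> clt I l ->
  cle (I -> T) (cpowlt bool l).
Proof.
move=> l0 Il; have [I0|I0] := pselect (cle nat I).
  by apply: cle_trans (infinite_functions_countable T I0) _; apply: (cpowltP l).1.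
exact: cle_trans (finite_functions_countable T I0) (cpowlt_infinite l0).
Qed.

(** * Closed discrete sets and the covering number *)

Definition has_small_covers (Y : topologicalType) (m : Type) : Prop :=
  forall F : set (set Y), open_cover F -> exists G : set (set Y),
    [/\ G `<=` F, \bigcup_(U in G) U = setT & clt (set_type G) m].

Lemma deltaP (Y : topologicalType) : exists2 M,
  is_cmin (has_small_covers Y) M & delta Y = (nat + M)%type.
Proof.
exists (cmin (has_small_covers Y)) => //; apply: cminP.
(* Any cover is a subset of [set Y], hence smaller than the power set of [set Y], and serves as its
   own subcover. *)
exists (set Y -> bool) => F [_ FT]; exists F; split=> //.
by apply: (cle_clt_trans (cle_set F)); apply: cleNclt; exact: cantor.
Qed.

(** As [z] ranges over the whole space and not only over [S], this expresses closedness together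
    with discreteness of the subspace. *)
Definition closed_discrete (T : topologicalType) (S : set T) : Prop :=
  forall z, \forall y \near z, S y -> y = z.

Lemma closed_discrete_sub (T : topologicalType) (S S' : set T) :
  S `<=` S' -> closed_discrete S' -> closed_discrete S.
Proof. by move=> SS' h z; apply: filterS (h z) => y zy /SS'. Qed.

Lemma closed_discrete_closed (T : topologicalType) (S : set T) :
  closed_discrete S -> closed S.
Proof.
move=> h z /(_ _ (h z))[y [Sy /(_ Sy) <-]]; exact: Sy.
Qed.

(** Cover [closure A] by the traces of open sets [W z] that meet [S] at most in [z]: distinct points
    of [S] need distinct members of any subcover. *)
Lemma closed_discrete_lt_delta (T : topologicalType) (A S : set T) :
  S `<=` closure A -> closed_discrete S -> clt S (delta (closure A)).
Proof.
move=> SA Sd; have [M [Mcov _] ->] := deltaP (closure A).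
have /choice[W WP] (z : T) : exists W : set T, [/\ open W, W z & forall y, W y -> S y -> y = z].
  have : nbhs z [set y | S y -> y = z] by exact: Sd.
  rewrite nbhsE => -[W [oW Wz] Wsub].
  by exists W; split=> // y /Wsub.
pose F := [set U : set (closure A) | exists z, U = set_val @^-1` (W z)].
have [|G [GF GT Glt]] := Mcov F.
  split; first by move=> _ [z ->]; have [Wz _ _] := WP z; exists (W z).
  rewrite -subTset => y _; exists (set_val @^-1` (W (set_val y))); first by exists (set_val y).
  by have [] := WP (set_val y).
apply: (@clt_cle_trans M); last by apply: (@cle_inj _ _ inr) => ? ? [].
apply: cle_clt_trans Glt.
have /choice[g gP] (s : S) : exists U : G, exists2 y, (val U : set _) y & set_val y = set_val s.
  have sA : set_val s \in closure A by rewrite inE; apply/SA/set_mem; exact: valP.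
  have : (\bigcup_(U in G) U) (exist _ (set_val s) sA) by rewrite GT.
  by move=> [U /mem_set GU Us]; exists (exist _ U GU); eexists; [exact: Us|].
apply: (@cle_inj _ _ g) => s s' e; apply: val_inj => /=.
have [y gy ys] := gP s; have [y' gy' ys'] := gP s'.
have [z gz] := GF _ (set_mem (valP (g s))).
have [_ _ Wz] := WP z.
have sz : set_val s = z.
  by apply: Wz; [rewrite -ys; have := gy; rewrite gz|apply: set_mem; exact: valP].
have sz' : set_val s' = z.
  apply: Wz; last by apply: set_mem; exact: valP.
  by rewrite -ys'; have := gy'; rewrite -e gz.
exact: etrans sz (esym sz').
Qed.

Section metric.
Context {R : realType} {X : metricType R}.
Local Open Scope ring_scope.

Local Notation d := (@mdist R X).

Lemma near_mdistP (z : X) (P : set X) :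
  (\forall y \near z, P y) <-> exists2 e : R, 0 < e & forall y, d z y < e -> P y.
Proof.
split.
  by move=> /nbhs_ballP[e /= e0]; rewrite ballEmdist => h; exists e.
move=> [e e0 h]; apply/nbhs_ballP; exists e => //.
by rewrite ballEmdist => y /h.
Qed.

(** If the small ball around [z] contains a point [x] of [S] other than [z], then [x] is the only
    point of [S] there, and shrinking the radius to [d z x] excludes it. *)
Lemma locally_subsingleton_closed_discrete (S : set X) :
  (forall z, exists2 e : R, 0 < e &
     forall x y, S x -> S y -> d z x < e -> d z y < e -> x = y) ->
  closed_discrete S.
Proof.
move=> h z; have [e e0 ez] := h z; apply/near_mdistP.
have [[x [Sx xz zx]]|nx] := pselect (exists x, [/\ S x, x != z & d z x < e]).
  exists (d z x); first by rewrite mdist_gt0 eq_sym.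
  move=> y yx Sy; exfalso; have xy : x = y by apply: ez => //; exact: lt_trans yx _.
  by move: yx; rewrite xy ltxx.
exists e => // y zy Sy; apply: contrapT => /eqP yz; apply: nx; by exists y.
Qed.

Lemma separated_closed_discrete (S : set X) (e : R) : 0 < e ->
  (forall x y, S x -> S y -> d x y < e -> x = y) -> closed_discrete S.
Proof.
move=> e0 Se; apply: locally_subsingleton_closed_discrete => z.
exists (e / 2); first by rewrite divr_gt0.
move=> x y Sx Sy zx zy; apply: Se => //.
apply: le_lt_trans (metric_triangle x z y) _.
by rewrite [e]splitr ltrD// metric_sym.
Qed.

End metric.

(** The relation [r] may be asymmetric, as it is when the permitted distance depends on the first
    point; hence the two alternatives at the end. *)
Lemma maximal_free (T : Type) (C : set T) (r : T -> T -> Prop) :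
  exists D : set T, [/\ D `<=` C, forall x y, D x -> D y -> r x y -> x = y &
    forall y, C y -> D y \/ exists2 x, D x & r x y \/ r y x].
Proof.
pose P (D : set T) := D `<=` C /\ forall x y, D x -> D y -> r x y -> x = y.
have [|D [[DC Dr] Dmax]] := @Zorn_bigcup _ P.
  move=> F FP Ftot; split; first by move=> x [X FX Xx]; exact: (FP _ FX).1.
  move=> x y [X FX Xx] [Y FY Yy]; have [XY|YX] := Ftot _ _ FX FY.
  - by apply: (FP _ FY).2 => //; exact: XY.
  - by apply: (FP _ FX).2 => //; exact: YX.
exists D; split=> // y Cy; apply: contrapT => /not_orP[nDy nr].
apply: (Dmax (D `|` [set y])).
  split; first by move=> x; left.
  by move=> /(_ y (or_intror erefl)).
split; first by move=> x [/DC//|->].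
move=> x z [Dx|->] [Dz|->] //; first exact: Dr.
- by move=> xy; exfalso; apply: nr; exists x => //; left.
- by move=> yz; exfalso; apply: nr; exists z => //; right.
Qed.

(** Since [m] is infinite and below [delta], some open cover [F] has no subcover of size < [m]. A
    closed discrete [D] is built such that one member of [F] per point of [D] already covers, so [D]
    has size at least [m]. *)
Lemma large_closed_discrete (R : realType) (X : metricType R) (A : set X) (m : Type) :
  cle nat m -> clt m (delta (closure A)) ->
  exists2 S : set X, S `<=` closure A /\ closed_discrete S & cle m S.
Proof.
move=> m0; have [M [_ Mmin] ->] := deltaP (closure A) => -[_ nMm].
have /existsNP[F /not_implyP[[Fo FT] FN]] : ~ has_small_covers (closure A) m.
  by move=> /Mmin Mm; apply: nMm; exact: (infinite_add m0 m0 Mm).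
set C := closure A in F Fo FT FN *; pose d := @mdist R X.
pose P x (e : R) := [/\ 0 < e, e <= 1 &
  exists2 U, F U & forall y : C, d x (set_val y) < e -> U y]%R.
(* Up to a factor 2, [rho x] is the largest radius [<= 1] of a ball around [x] whose
   trace on [C] lies in a member of [F]. *)
have /choice[rho rhoP] (x : X) : exists r, C x -> P x r /\ forall e, P x e -> (e <= 2 * r)%R.
  have [Cx|] := pselect (C x); last by exists 0%R.
  have [e0 Pe0] : exists e, P x e.
    have [U FU Ux] : (\bigcup_(U in F) U) (exist _ x (mem_set Cx)) by rewrite FT.
    have [V oV VU] := Fo _ FU.
    have /near_mdistP[e e0 eV] : \forall y \near x, V y.
      by apply: open_nbhs_nbhs; split=> //; move: Ux; rewrite -VU.
    exists (Num.min e 1%R); split; [by rewrite lt_min e0 ltr01|by rewrite ge_min lexx orbT|].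
    by exists U => // y; rewrite lt_min => /andP[/eV + _]; rewrite -VU.
  have Esup : has_sup [set e | P x e].
    by split; [exists e0|exists 1%R => e []].
  have s0 : (0 < sup [set e | P x e])%R.
    by have [+ _ _] := Pe0 => /lt_le_trans; apply; apply: (ub_le_sup Esup.2).
  (* An admissible radius above half the supremum; the supremum itself need not be admissible. *)
  have [e Pe es] := sup_adherent (divr_gt0 s0 (ltr0n R 2)) Esup.
  exists e => _; split=> // e' Pe'; apply: le_trans (ub_le_sup Esup.2 Pe') _.
  lra.
have rho0 x : C x -> (0 < rho x)%R by move=> /rhoP[[]].
have rhoS x y e : C x -> C y -> (0 < e)%R -> (d x y + e <= rho x)%R -> (e <= 2 * rho y)%R.
  move=> Cx Cy e0 xye; have [[_ r1 [U FU Ux]] _] := rhoP _ Cx.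
  apply: (rhoP _ Cy).2; split=> //.
    by apply: le_trans r1; apply: le_trans xye; rewrite lerDr mdist_ge0.
  exists U => // z yz; apply: Ux; apply: lt_le_trans xye.
  by apply: le_lt_trans (metric_triangle x y _) _; rewrite ltrD2l.
(* [rho] is comparable at nearby points, so the points of a maximal such [D] are
   locally separated, and the balls of radius [rho] around them cover [C]. *)
have [D [DC Dfree Dmax]] := maximal_free C (fun x y => d x y < rho x / 8)%R.
exists D.
  split=> //.
  apply: locally_subsingleton_closed_discrete => z.
  have [Cz|nCz] := pselect (C z); last first.
    have /near_mdistP[e e0 eC] : \forall y \near z, ~ C y.
      by apply: open_nbhs_nbhs; split=> //; apply: closed_openC; exact: closed_closure.
    by exists e => // x y /DC Cx _ /eC.
  have z0 := rho0 _ Cz.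
  (* For [x] this close to [z], [rhoS] gives [rho z / 2 <= 2 * rho x]; so two such points have
     distance below [rho z / 32 <= rho x / 8]. *)
  exists (rho z / 64)%R; first by rewrite divr_gt0.
  move=> x y Dx Dy zx zy; apply: Dfree => //.
  have xy : (d x y <= d z x + d z y)%R.
    by rewrite [d z x]metric_sym; exact: metric_triangle.
  have := @rhoS z x (rho z / 2)%R Cz (DC _ Dx); rewrite divr_gt0// => /(_ isT).
  move: zx zy xy; rewrite -/d => zx zy xy.
  by move=> h; have := h (ltac:(lra)); lra.
have /choice[U UP] (x : X) : exists U, C x -> F U /\ forall y : C, (d x (set_val y) < rho x)%R -> U y.
  have [Cx|] := pselect (C x); last by exists set0.
  by have [[_ _ [U FU Ux]] _] := rhoP _ Cx; exists U.
have Gcov : cle m [set U x | x in D].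
  apply: cltNcle => Glt; apply: FN; exists [set U x | x in D]; split=> //.
    by move=> _ [x /DC Cx <-]; have [] := UP _ Cx.
  rewrite -subTset => y _; have Cy : C (set_val y) := set_mem (valP y).
  have y0 := rho0 _ Cy.
  have [Dy|[x Dx xy]] := Dmax _ Cy.
    exists (U (set_val y)); first by exists (set_val y).
    by apply: (UP _ Cy).2; rewrite /d mdistxx.
  exists (U x); first by exists x.
  apply: (UP _ (DC _ Dx)).2; have x0 := rho0 _ (DC _ Dx).
  (* If the distance is only known to be below an eighth of [rho] at [y], then [rhoS] bounds [rho x]
     below by a quarter of it. *)
  case: xy => xy; first by lra.
  have := @rhoS _ x (rho (set_val y) / 2)%R Cy (DC _ Dx); rewrite divr_gt0// => /(_ isT).
  move=> h; have := h (ltac:(lra)); rewrite /d metric_sym -/d.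
  by move: xy; rewrite -/d; lra.
apply: cle_trans Gcov _.
have UD (x : D) : U (set_val x) \in [set U x | x in D].
  by rewrite inE; exists (set_val x) => //; apply: set_mem; exact: valP.
pose g (x : D) : [set U x | x in D] := exist _ (U (set_val x)) (UD x).
apply: (@cle_surj _ _ g) => -[V VP]; have [x Dx xV] := set_mem VP.
by exists (exist _ x (mem_set Dx)); apply: val_inj.
Qed.

(** * Lower bounds for the weight *)

Section lower_bounds.
Context {R : realType}.
Local Open Scope ring_scope.

Lemma metric_normal (X : metricType R) : normal_space X.
Proof.
apply/(@normal_openP R) => A B cA cB AB0; pose d := @mdist R X.
(* The union of the balls around points of [P] with radius at most half the distance to [Q]. If
   balls of radii [e] and [e'] around [a] and [b] met, [d a b < e + e'] would contradict
   [2 * e <= d a b] and [2 * e' <= d a b]. *)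
pose N (P Q : set X) := [set x | exists a e, [/\ 0 < e, P a, d a x < e &
  forall b, Q b -> e * 2 <= d a b]].
have No P Q : open (N P Q).
  rewrite openE => x [a [e [e0 Pa ax Qe]]]; apply/near_mdistP.
  exists (e - d a x); first by rewrite subr_gt0.
  move=> y xy; exists a, e; split=> //.
  by apply: le_lt_trans (metric_triangle a x y) _; move: xy; rewrite -!/d; lra.
have NP P Q : closed Q -> P `&` Q = set0 -> P `<=` N P Q.
  move=> cQ PQ0 a Pa; have /near_mdistP[e e0 eQ] : \forall y \near a, ~ Q y.
    apply: open_nbhs_nbhs; split; first exact: closed_openC.
    by move=> Qa; suff: (P `&` Q) a by rewrite PQ0.
  exists a, (e / 2); split=> //; rewrite ?divr_gt0// /d ?mdistxx ?divr_gt0//.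
  by move=> b Qb; rewrite leNgt; apply/negP; rewrite mulfVK// => /eQ.
exists (N A B), (N B A); split=> //; [exact: NP|by apply: NP; rewrite // setIC|].
rewrite -subset0 => x [[a [e [e0 Aa ax Be]]] [b [e' [e'0 Bb bx Ae']]]].
have := metric_triangle a x b; rewrite [mdist x b]metric_sym -/d.
by have := Be _ Bb; have := Ae' _ Aa; rewrite /d [mdist b a]metric_sym -/d; lra.
Qed.

Lemma separating_function (X : metricType R) (A B : set X) :
  closed A -> closed B -> A `&` B = set0 ->
  exists f : continuousType X R, (forall x, A x -> f x = 0) /\ (forall x, B x -> f x = 1).
Proof.
move=> cA cB AB0; have /(@normal_separatorP R) := @metric_normal X.
move=> /(_ _ _ cA cB AB0) /(@uniform_separatorP _ R)[f [fc _ fA fB]].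
exists (mkcts fc : continuousType X R); split=> x Px.
- by apply: fA; exists x.
- by apply: fB; exists x.
Qed.

Lemma nbhs_tauP (X : topologicalType) (B : bornology X) (f : Ctau R B) (U : set (Ctau R B)) :
  nbhs f U <-> exists A (e : R), [/\ born B A, 0 < e &
    forall g : Ctau R B, (forall x, A x -> `|f x - g x| < e) -> U g].
Proof.
rewrite -nbhs_entourageE; split.
  move=> [E [[A e] /= [BA e0] sub] EU]; exists A, e; split=> // g fg.
  by apply: EU; apply/xsectionP; exact: sub.
move=> [A [e [BA e0 sub]]]; exists (@tau_basic R X B A e); first by exists (A, e).
by move=> g /xsectionP; exact: sub.
Qed.

Lemma weightP (T : topologicalType) :
  exists2 F : set (set T), basis F & weight T = (nat + F)%type.
Proof.
have [|[F bF FE] _] := @cminP (fun k => exists2 F : set (set T), basis F & k = set_type F).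
  exists (set_type (@open T)), (@open T) => //; split=> // x U.
  by rewrite /= nbhsE => -[V [oV Vx] VU]; exists V.
by exists F; rewrite // /weight FE.
Qed.

Lemma weight_le (T : topologicalType) (F : set (set T)) (C : Type) :
  cle nat C -> basis F -> cle F C -> cle (weight T) C.
Proof.
move=> C0 bF FC; apply: infinite_add => //; apply: cle_trans FC.
have [|_] := @cminP (fun k => exists2 F : set (set T), basis F & k = set_type F).
  by exists (set_type F), F.
by apply; exists F.
Qed.

Lemma cf_le (T : Type) (B : bornology T) (B0 : set (set T)) (C : Type) :
  cle nat C -> born_base B B0 -> cle B0 C -> cle (cf B) C.
Proof.
move=> C0 bB0 BC; apply: infinite_add => //; apply: cle_trans BC.
have [|_] := @cminP (fun k => exists2 B0, born_base B B0 & k = set_type B0).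
  by exists (set_type B0), B0.
by apply; exists B0.
Qed.

Lemma cfP (T : Type) (B : bornology T) :
  exists2 B0, born_base B B0 & cf B = (nat + set_type B0)%type.
Proof.
have [|[B0 bB0 E] _] := @cminP (fun k => exists2 B0, born_base B B0 & k = set_type B0).
  by exists (set_type (born B)), (born B) => //; split=> // A BA; exists A.
by exists B0; rewrite // /cf E.
Qed.

Lemma born_closure (T : topologicalType) (B : bornology T) (A : set T) :
  has_closed_base B -> born B A -> born B (closure A).
Proof.
move=> [B0 [B0B B0P] B0c] /B0P[A0 B0A0 AA0].
apply: (@born_sub _ _ _ A0); last exact: B0B.
have /closure_id -> := B0c _ B0A0; exact: closureS.
Qed.

(** Each basic open [U] around 0 controls functions on some bounded [D U]. If [U] forces [|g| < 1]
    on [A], then [A] lies in [closure (D U)]: otherwise a Urysohn function vanishing on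
    [closure (D U)] and equal to 1 at a point of [A] would belong to [U]. *)
Lemma cf_le_weight (X : metricType R) (B : bornology X) :
  has_closed_base B -> cle (cf B) (weight (Ctau R B)).
Proof.
move=> cB; have [F [Fo Fnb] ->] := weightP (Ctau R B).
(* Separating the whole space from the empty set yields the zero function. *)
have [z [z0 _]] := separating_function (@closedT X) (@closed0 X) (setI0 _).
pose f0 : Ctau R B := z.
have /choice[D DP] (U : set (Ctau R B)) : exists A, F U -> U f0 -> born B A /\
    exists2 e : R, 0 < e & forall g : Ctau R B, (forall x, A x -> `|f0 x - g x| < e) -> U g.
  have [[FU Uf]|n] := pselect (F U /\ U f0); last by exists set0 => FU Uf; case: n.
  have /nbhs_tauP[A [e [BA e0 AU]]] : nbhs f0 U by apply: open_nbhs_nbhs; split=> //; exact: Fo.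
  by exists A; split=> //; exists e.
pose F0 := [set U | F U /\ U f0].
apply: (@cf_le _ _ [set closure (D U) | U in F0]).
- by apply: (@cle_inj _ _ inl) => ? ? [].
- split=> [_ [U [FU Uf] <-]|A BA]; first by apply: born_closure => //; have [] := DP _ FU Uf.
  have [|U [FU Uf] UA] := Fnb f0 [set g | forall x, A x -> `|f0 x - g x| < 1].
    by apply/nbhs_tauP; exists A, 1.
  exists (closure (D U)); first by exists U.
  move=> x Ax; apply: contrapT => nDx.
  have cx : closed [set x].
    by apply: accessible_closed_set1; apply: hausdorff_accessible; exact: metric_hausdorff.
  have [|f [fD fx]] := separating_function (@closed_closure _ (D U)) cx.
    by rewrite -subset0 => y [Dy yx]; apply: nDx; rewrite -yx.
  have [_ [e e0 eU]] := DP _ FU Uf.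
  have : [set g : Ctau R B | forall x, A x -> `|f0 x - g x| < 1] f.
    apply: UA; apply: eU => y Dy; rewrite fD ?z0 ?subrr ?normr0//.
    exact: subset_closure.
  by move=> /(_ x Ax); rewrite fx// z0// sub0r normrN normr1 ltxx.
- apply: (@cle_trans F); last by apply: (@cle_inj _ _ inr) => ? ? [].
  apply: (@cle_trans F0); last by apply: cle_subset => U [].
  have DF (U : F0) : closure (D (set_val U)) \in [set closure (D U) | U in F0].
    by rewrite inE; exists (set_val U) => //; apply: set_mem; exact: valP.
  pose g (U : F0) : [set closure (D U) | U in F0] := exist _ (closure (D (set_val U))) (DF U).
  apply: (@cle_surj _ _ g) => -[V VP]; have [U FU UV] := set_mem VP.
  by exists (exist _ U (mem_set FU)); apply: val_inj.
Qed.

(** Choose for each [P] a basic set [W P] around [f P], inside the unit ball over [S]. If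
    [W P = W P'], then [f P] and [f P'] differ by less than 1 on [S], where their values are 0 or
    1. *)
Lemma pow_discrete_le_weight (X : metricType R) (B : bornology X) (S : set X) :
  born B S -> closed_discrete S -> cle (S -> bool) (weight (Ctau R B)).
Proof.
move=> BS Sd; have [F [Fo Fnb] ->] := weightP (Ctau R B).
apply: (@cle_trans F); last by apply: (@cle_inj _ _ inr) => ? ? [].
pose pos (P : S -> bool) := [set x | exists2 s : S, set_val s = x & P s].
pose neg (P : S -> bool) := [set x | exists2 s : S, set_val s = x & ~~ P s].
have cl (Q : set X) : Q `<=` S -> closed Q.
  by move=> QS; apply: closed_discrete_closed; exact: closed_discrete_sub Sd.
have /choice[f fP] (P : S -> bool) : exists f : Ctau R B,
    forall s : S, f (set_val s) = (P s)%:R.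
  have [| | |f [f0 f1]] := @separating_function X (neg P) (pos P).
  - by apply: cl => _ [s <- _]; apply: set_mem; exact: valP.
  - by apply: cl => _ [s <- _]; apply: set_mem; exact: valP.
  - rewrite -subset0 => x [[s <- /negP nPs] [s' /val_inj -> ?]] //.
  exists f => s; case: (boolP (P s)) => Ps; first by apply: f1; exists s.
  by apply: f0; exists s.
have /choice[W WP] (P : S -> bool) : exists W : F, (val W : set _) (f P) /\
    forall g : Ctau R B, (val W : set _) g -> forall x, S x -> `|f P x - g x| < 1.
  have [|W [FW Wf] WS] := Fnb (f P) [set g | forall x, S x -> `|f P x - g x| < 1].
    by apply/nbhs_tauP; exists S, 1.
  by exists (exist _ W (mem_set FW)).
apply: (@cle_inj _ _ W) => P P' e; apply/funext => s.
have [_ WS] := WP P; have [Wf _] := WP P'.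
have : S (set_val s) by apply: set_mem; exact: valP.
move: Wf; rewrite -e => /WS /[apply]; rewrite !fP.
by case: (P s) (P' s) => -[] //; rewrite ?subr0 ?sub0r ?normrN normr1 ltxx.
Qed.

Lemma born_deltaP (T : topologicalType) (B : bornology T) :
  (forall A, born B A -> cle (delta (closure A)) (born_delta B)) /\
  (forall S, (forall A, born B A -> cle (delta (closure A)) S) -> cle (born_delta B) S).
Proof.
(* The disjoint union of all these cardinals is an upper bound, so the supremum exists. *)
have [|ub least] := @csupP (fun d => exists2 A, born B A & d = delta (set_type (closure A)))
    {A : set T & delta (closure A)}.
  move=> _ [A _ ->]; apply: (@cle_inj _ _ (existT _ A)) => x y.
  exact: (@existT_inj2 {classic (set T)}).
split=> [A BA|S h]; first by apply: ub; exists A.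
by apply: least => _ [A BA ->]; exact: h.
Qed.

Lemma born_delta_infinite (T : topologicalType) (B : bornology T) :
  cle nat (born_delta B).
Proof.
have [/(_ set0 (born0 _)) + _] := born_deltaP B; apply: cle_trans.
by have [M _ ->] := deltaP (closure (@set0 T)); apply: (@cle_inj _ _ inl) => ? ? [].
Qed.

Lemma cpowlt_le_weight (X : metricType R) (B : bornology X) :
  has_closed_base B -> cle (cpowlt bool (born_delta B)) (weight (Ctau R B)).
Proof.
move=> cB; apply: (cpowltP _).2 => m [_ nm].
have [m0|m0] := pselect (cle nat m); last first.
  apply: cle_trans (finite_functions_countable bool m0) _.
  by have [F _ ->] := weightP (Ctau R B); apply: (@cle_inj _ _ inl) => ? ? [].
have [A BA] : exists2 A, born B A & clt m (delta (closure A)).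
  apply: contrapT => h; apply: nm; apply: (born_deltaP B).2 => A BA.
  by apply: cltNcle => mA; apply: h; exists A.
move=> /(large_closed_discrete m0)[S [SA Sd] mS].
apply: cle_trans (cle_pow2 mS) _; apply: pow_discrete_le_weight => //.
by apply: born_sub SA _; exact: born_closure.
Qed.

End lower_bounds.

(** * Coding continuous functions up to uniform distance *)

Section codes.
Context {R : realType} {X : metricType R}.
Local Open Scope ring_scope.

Local Notation d := (@mdist R X).
Local Notation r := (@harmonic R).
Let mdist_tri x y z : d x z <= d x y + d y z. Proof. exact: metric_triangle. Qed.
Let mdistC x y : d x y = d y x. Proof. exact: metric_sym. Qed.

Lemma harmonic_small (e : R) : 0 < e -> exists N : nat, forall n, (N <= n)%N -> r n < e.
Proof.
move=> e0; have [N _ h] := near_infty_natSinv_lt (PosNum e0).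
by exists N => n; exact: h.
Qed.

(** Rounding turns real samples into integers, so that a family of samples takes values in a
    countable type. *)
Lemma floor_eq_dist (x y e : R) : 0 < e ->
  Num.floor (x / e) = Num.floor (y / e) -> `|x - y| < e.
Proof.
move=> e0 h.
suff : `|x / e - y / e| < 1.
  by rewrite -mulrBl normrM normfV (gtr0_norm e0) ltr_pdivrMr// mul1r.
have /andP[] := floor_itv (x / e); have /andP[] := floor_itv (y / e).
by rewrite h intrD ltr_norml => ? ? ? ?; apply/andP; split; lra.
Qed.

Lemma net (P : set X) (e : R) : 0 < e -> exists D : set X,
  [/\ D `<=` P, closed_discrete D & forall y, P y -> exists2 x, D x & d x y < e].
Proof.
move=> e0; have [D [DP Dfree Dmax]] := maximal_free P (fun x y => d x y < e).
exists D; split=> //; first exact: separated_closed_discrete e0 Dfree.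
move=> y /Dmax[Dy|[x Dx xy]]; first by exists y; rewrite // mdistxx.
by exists x => //; case: xy => //; rewrite mdistC.
Qed.

(** Near [z] only the finitely many [S n] with [n < N] matter, and their neighbourhoods can be
    intersected. *)
Lemma bigcup_closed_discrete (S : nat -> set X) :
  (forall n, closed_discrete (S n)) ->
  (forall z : X, exists N, \forall y \near z, forall n, (N <= n)%N -> ~ S n y) ->
  closed_discrete (\bigcup_n S n).
Proof.
move=> Sd Slf z; have [N zN] := Slf z.
have zlt : \forall y \near z, forall n, (n < N)%N -> S n y -> y = z.
  elim: N {zN} => [|N IH]; first by apply: nearW.
  near=> y => n; rewrite ltnS leq_eqVlt => /orP[/eqP ->|nN].
    by near: y; exact: Sd.
  by have : forall n, (n < N)%N -> S n y -> y = z by [near: y; exact: IH]; apply.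
near=> y => -[n _ Sny]; have [Nn|nN] := leqP N n.
- have : forall n, (N <= n)%N -> ~ S n y by near: y.
  by move=> /(_ n Nn).
- by have : forall n, (n < N)%N -> S n y -> y = z by [near: y]; apply; [exact: nN|].
Unshelve. all: by end_near. Qed.

(** Replaces the varying sets [S] by one index type [D]; [x0] is the value at indices that code no
    point of [S]. *)
Lemma cle_set_parametrization (S : set X) (D : Type) (x0 : X) : cle S D ->
  exists h : D -> X, forall s, S s -> exists u, h u = s.
Proof.
move=> /cleP[f fi].
have /choice[h hP] (u : D) : exists x, forall s : S, f s = u -> x = set_val s.
  have [[s su]|n] := pselect (exists s : S, f s = u); last first.
    by exists x0 => s su; case: n; exists s.
  by exists (set_val s) => s' s'u; congr set_val; apply: fi; rewrite su.
by exists h => s Ss; exists (f (exist _ s (mem_set Ss))); rewrite (hP _ _ erefl).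
Qed.

Lemma range_infinite (x : nat -> X) :
  (forall z, exists N, forall n, (N <= n)%N -> x n <> z) -> cle nat (range x).
Proof.
move=> /choice[N NP]; apply: contrapT => nx.
have /finite_seqP[s sE] : finite_set (range x).
  apply: contrapT => /infiniteP xi; apply: nx; apply: card_le_trans xi _.
  by have /card_eqPle[] := card_setT (range x).
pose n := (\max_(z <- s) N z)%N.
have : [set` s] (x n) by rewrite -sE; exists n.
by move=> /= xs; apply: (NP (x n) n) => //; exact: leq_bigmax_seq.
Qed.

(** The stage [n] depends on the function, so it is recorded in the code next to the sample; equal
    codes then compare samples of the same stage. *)
Lemma sample_code (F P : Type) (V : nat -> Type) (good : nat -> F -> Prop)
    (s : forall n, F -> V n) :
  cle nat P -> (forall n, cle (V n) P) -> (forall f, exists n, good n f) ->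
  exists code : F -> P, forall f g, code f = code g ->
    exists n, [/\ good n f, good n g & s n f = s n g].
Proof.
move=> P0 VP /choice[N NP]; have /cleP[j ji] := infinite_sigma P0 VP.
exists (fun f => j (existT _ (N f) (s (N f) f))) => f g /ji e.
have eN : N f = N g := congr1 (@projT1 _ _) e.
exists (N f); split=> //; first by rewrite eN.
by move: e; rewrite -eN => h; exact: (@existT_inj2 nat V _ _ _ h).
Qed.

Lemma continuous_near (f : continuousType X R) (x : X) (e : R) : 0 < e ->
  \forall y \near x, `|f x - f y| < e.
Proof. by move=> e0; have /cvgrPdist_lt := @cts_fun _ _ f x; apply. Qed.

Lemma sample_dist (e : R) (f g : R) (f' g' : R) : 0 < e ->
  `|f - f'| < e -> `|g - g'| < e -> Num.floor (f' / e) = Num.floor (g' / e) ->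
  `|f - g| < 3 * e.
Proof.
move=> e0 ff gg /(floor_eq_dist e0) fg.
have -> : f - g = (f - f') + (f' - g') - (g - g') by ring.
apply: le_lt_trans (ler_normB _ _) _.
by have := ler_normD (f - f') (f' - g'); lra.
Qed.

Lemma dense_sample_dist (J : Type) (h : J -> X) (e : R) (f g : continuousType X R) (x : X) :
  0 < e -> (forall t, 0 < t -> exists j, d x (h j) < t) ->
  (forall j, Num.floor (f (h j) / e) = Num.floor (g (h j) / e)) ->
  `|f x - g x| < 3 * e.
Proof.
move=> e0 hx fg.
have /near_mdistP[t t0 tP] : \forall y \near x, `|f x - f y| < e /\ `|g x - g y| < e.
  by near=> y; split; near: y; exact: continuous_near.
have [j /tP[fj gj]] := hx _ t0; exact: sample_dist e0 fj gj (fg j).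
Unshelve. all: by end_near. Qed.

Lemma code_function (C : set X) (l : Type) (e : R) : cle nat l ->
  (forall S : set X, S `<=` C -> closed_discrete S -> clt S l) -> 0 < e ->
  exists code : continuousType X R -> cpowlt bool l,
    forall f g, code f = code g -> forall x, C x -> `|f x - g x| < 3 * e.
Proof.
move=> l0 Cl e0.
have P0 := cpowlt_infinite l0.
have /choice[D DP] (n : nat) : exists D : set X, [/\ D `<=` C, closed_discrete D &
    forall y, C y -> exists2 x, D x & d x y < r n] by apply: net; exact: harmonic_gt0.
have Dlt n : clt (D n) l by have [DC Dd _] := DP n; exact: Cl.
pose q (f : continuousType X R) (y : X) : int := Num.floor (f y / e).
have [[m [ml m0 Dm]]|nm] := pselect (exists m, [/\ clt m l, cle nat m & forall n, cle (D n) m]).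
  (* The union of all the nets [D n] is dense in [C], and its size is at most [m]. *)
  pose I := {n & D n}.
  have Il : clt I l by apply: cle_clt_trans ml; exact: infinite_sigma.
  pose h (i : I) := set_val (projT2 i).
  have [|code codeP] := @sample_code (continuousType X R) _ (fun=> I -> int) (fun _ _ => True)
      (fun _ f i => q f (h i)) P0 (fun=> cpowlt_functions int l0 Il).
    by exists 0%N.
  exists code => f g /codeP[_ [_ _ fg]] x Cx.
  apply: (@dense_sample_dist _ h) => //; last by move=> i; exact: (congr1 (fun k => k i) fg).
  move=> t t0; have [N NP] := harmonic_small t0; have [_ _ /(_ _ Cx)[u Du ux]] := DP N.
  exists (existT _ N (exist _ u (mem_set Du))); rewrite mdistC.
  exact: lt_trans ux (NP _ (leqnn N)).
have {}nm m : clt m l -> cle nat m -> exists n, ~ cle (D n) m.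
  by move=> ml m0; apply/existsNP => h; apply: nm; exists m.
pose nearC n x := C `&` [set y | d x y < r n].
(* For [l = aleph_0] the sets [G n] are empty, and [goodP] says that [f] is uniformly
   continuous on [C] up to [e]. *)
pose G n := [set x | [/\ C x, clt nat l & forall S : set X, S `<=` nearC n x ->
  closed_discrete S -> ~ cle (D n) S]].
(* A dense family for [G n]: take a net [T] of [G n] and, around each of its points, finer and finer
   nets of [nearC]. By definition of [G n] these are smaller than [D n], so [T * nat * D n] indexes
   them all. *)
have /choice[Jh JhP] (n : nat) : exists Jh : {J : Type & J -> X}, clt (projT1 Jh) l /\
    forall x, G n x -> forall t, 0 < t -> exists j, d x (projT2 Jh j) < t.
  have [Nl|nNl] := pselect (clt nat l); last first.
    by exists (existT _ (D n : Type) set_val); split; [exact: Dlt|move=> x []].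
  have [T [TG Td Tnet]] := net (G n) (harmonic_gt0 n).
  have /choice[S SP] (tm : T * nat) : exists S : set X, [/\ S `<=` nearC n (set_val tm.1),
      closed_discrete S & forall y, nearC n (set_val tm.1) y -> exists2 x, S x & d x y < r tm.2].
    by apply: net; exact: harmonic_gt0.
  have /choice[h hP] (tm : T * nat) : exists h : D n -> X, forall s, S tm s -> exists u, h u = s.
    apply: (cle_set_parametrization (set_val tm.1)).
    have [Ssub Sd _] := SP tm; have [_ _ GP] := TG _ (set_mem (valP tm.1)).
    by apply/clt_cle/cleNclt; exact: GP.
  exists (existT (fun J => J -> X) (T * nat * D n)%type (fun x => h x.1 x.2)); split=> /=.
    have Tl : clt T l by apply: Cl => // x /TG[].
    exact: (clt_mul Nl (clt_mul Nl Tl Nl) (Dlt n)).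
  move=> x Gx t t0; have [N NP] := harmonic_small t0.
  have [u Tu ux] := Tnet _ Gx; pose tm := (exist _ u (mem_set Tu) : T, N).
  have [_ _ /(_ x)[|s Ss sx]] := SP tm; first by split=> //; case: Gx.
  have [v hv] := hP _ _ Ss; exists (tm, v) => /=.
  by rewrite hv mdistC; exact: lt_trans sx (NP _ (leqnn N)).
pose J n := projT1 (Jh n); pose h n : J n -> X := projT2 (Jh n).
pose good n (f : continuousType X R) := forall x y, C x -> ~ G n x -> C y ->
  d x y < r n -> `|f x - f y| < e.
have goodP f : exists n, good n f.
  apply: contrapT => /forallNP ng.
  have /choice[x xP] n : exists x, [/\ C x, ~ G n x & exists y,
      d x y < r n /\ e <= `|f x - f y|].
    have /existsNP[x /existsNP[y /not_implyP[Cx]]] := ng n.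
    move=> /not_implyP[nG /not_implyP[Cy /not_implyP[xy /negP]]].
    by rewrite -leNgt => exy; exists x; split=> //; exists y.
  (* The bad balls eventually keep a fixed distance from [z]. A point [y] of such a ball within
     [t / 4] of [z], with [r n < t / 4], would put [x n] and its bad partner [w] within [t] of [z],
     where [f] is within [e / 2] of [f z]. *)
  have xfar z : exists N, exists2 t : R, 0 < t & forall n y, (N <= n)%N -> d (x n) y < r n -> t <= d z y.
    have e20 : 0 < e / 2 by rewrite divr_gt0.
    have /near_mdistP[t t0 tP] := continuous_near f z e20.
    have t40 : 0 < t / 4 by rewrite divr_gt0.
    have [N NP] := harmonic_small t40.
    exists N, (t / 4) => // n y Nn xny; rewrite leNgt; apply/negP => zy.
    have [_ _ [w [xnw]]] := xP n; apply/negP; rewrite -ltNge.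
    have rn := NP _ Nn.
    have zx : d z (x n) < t / 2.
      have := mdist_tri z y (x n); rewrite [mdist y _]mdistC; lra.
    have zw : d z w < t by have := mdist_tri z (x n) w; lra.
    have fx : `|f z - f (x n)| < e / 2 by apply: tP; lra.
    have fw : `|f z - f w| < e / 2 by apply: tP; lra.
    have -> : f (x n) - f w = (f z - f w) - (f z - f (x n)) by ring.
    by apply: le_lt_trans (ler_normB _ _) _; lra.
  have lf (S : nat -> set X) : (forall n, S n `<=` nearC n (x n)) ->
      (forall n, closed_discrete (S n)) -> clt (\bigcup_n S n) l.
    move=> Sx Sd; apply: Cl; first by move=> y [n _ /Sx[]].
    apply: bigcup_closed_discrete => // z; have [N [t t0 tP]] := xfar z.
    exists N; apply/near_mdistP; exists t => // y zy n Nn /Sx[_ /= /(tP _ _ Nn)].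
    by rewrite leNgt zy.
  have [Nl|nNl] := pselect (clt nat l).
    (* Since [x n] is outside [G n], its ball contains a closed discrete set as large as [D n]; the
       union over [n] bounds all [D n] below [l], contradicting [nm]. *)
    have /choice[S SP] n : exists S : set X, [/\ S `<=` nearC n (x n), closed_discrete S & cle (D n) S].
      apply: contrapT => /forallNP nS; have [Cx nG _] := xP n; apply: nG; split=> // S Sx Sd DS.
      by apply: (nS S).
    have Ul : clt (\bigcup_n S n) l by apply: lf => n; have [] := SP n.
    have [m [ml m0 Um _]] := clt_ub Nl Ul Ul.
    have [n] := nm _ ml m0; apply; apply: cle_trans Um.
    have [_ _ DS] := SP n; apply: cle_trans DS _.
    by apply: cle_subset; exact: bigcup_sup.
  (* When [l] is not above aleph_0, the bad points alone form an infinite closed discrete set, which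
     forces aleph_0 < [l]. *)
  have Ul : clt (\bigcup_n [set x n]) l.
    apply: lf => n; first by move=> _ ->; have [Cx _ _] := xP n; split; rewrite //= mdistxx harmonic_gt0.
    by apply: (@separated_closed_discrete _ _ _ 1) => // y z -> ->.
  apply: nNl; apply: cle_clt_trans Ul; rewrite (_ : \bigcup_n [set x n] = range x).
    apply: range_infinite => z; have [N [t t0 tP]] := xfar z; exists N => n Nn xz.
    have := tP n z Nn; rewrite xz mdistxx harmonic_gt0 => /(_ isT).
    by rewrite leNgt t0.
  by apply/seteqP; split=> [_ [n _ ->]|_ [n _ <-]]; exists n.
pose V n := ((D n -> int) * (J n -> int))%type.
have VP n : cle (V n) (cpowlt bool l).
  apply: infinite_mul => //; apply: cpowlt_functions => //; exact: (JhP n).1.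
have [code codeP] := @sample_code (continuousType X R) _ V good
  (fun n f => (fun u => q f (set_val u), fun j => q f (h n j))) P0 VP goodP.
exists code => f g /codeP[n [gf gg [Dfg Jfg]]] x Cx.
have [Gx|nGx] := pselect (G n x).
  apply: (@dense_sample_dist _ (h n)) => //; last by move=> j; exact: (congr1 (fun k => k j) Jfg).
  exact: (JhP n).2.
have [DC _ /(_ _ Cx)[u Du]] := DP n; rewrite mdistC => xu.
apply: (sample_dist e0 (gf x u Cx nGx (DC _ Du) xu) (gg x u Cx nGx (DC _ Du) xu)).
exact: (congr1 (fun k => k (exist _ u (mem_set Du))) Dfg).
Qed.

End codes.

(** * Upper bound for the weight *)

Section upper_bound.
Context {R : realType}.
Local Open Scope ring_scope.

(** A base is indexed by a set of the bornology base, a precision and a code: a representative of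
    each code class approximates every function of that class. *)
Lemma weight_le_cf_cpowlt (X : metricType R) (B : bornology X) :
  has_closed_base B ->
  cle (weight (Ctau R B)) (cf B * cpowlt bool (born_delta B))%type.
Proof.
move=> cB; set P := cpowlt bool (born_delta B).
have l0 : cle nat (born_delta B) := born_delta_infinite B.
have P0 : cle nat P := cpowlt_infinite l0.
have [B0 [B0B B0P] cfE] := cfP B.
have [f0 _] := separating_function (@closedT X) (@closed0 X) (setI0 _).
have [i0 i0inj] : exists i : nat -> cf B, injective i.
  by rewrite cfE; exists inl => ? ? [].
have [j0 j0inj] : exists j : nat -> P, injective j by exact/cleP.
have C0 : cle nat (cf B * P)%type.
  by apply: (@cle_inj _ _ (fun n => (i0 n, j0 n))) => n m [/i0inj].
have /choice[code codeP] (Ak : B0 * nat) : exists code : continuousType X R -> P,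
    forall f g, code f = code g -> forall x, (set_val Ak.1) x ->
      `|f x - g x| < 3 * @harmonic R Ak.2.
  have BA : born B (set_val Ak.1) by apply/B0B/set_mem; exact: valP.
  have [|code codeP] := @code_function R X (closure (set_val Ak.1)) _ _ l0 _ (harmonic_gt0 Ak.2).
    move=> S SA Sd; apply: clt_cle_trans (closed_discrete_lt_delta SA Sd) _.
    exact: (born_deltaP B).1.
  by exists code => f g /codeP fg x Ax; apply: fg; exact: subset_closure.
pose I := (B0 * nat * P)%type.
have /choice[h hP] (i : I) : exists h : Ctau R B, forall f, code i.1 f = i.2 -> code i.1 h = i.2.
  have [[f fi]|n] := pselect (exists f, code i.1 f = i.2); first by exists f.
  by exists f0 => f fi; case: n; exists f.
(* With [r] the precision, functions of equal code are within [3 * r]; radius [4 * r] leaves room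
   for an [r]-ball around each of them, so each lies in the interior. *)
pose W (i : I) : set (Ctau R B) := interior [set g : Ctau R B |
  forall x, (set_val i.1.1) x -> `|h i x - g x| < 4 * @harmonic R i.1.2].
apply: (@weight_le _ (range W)) => //; last first.
  apply: (@cle_trans I).
    have WP (i : I) : W i \in range W by rewrite inE; exists i.
    pose g i : range W := exist _ (W i) (WP i).
    apply: (@cle_surj _ _ g) => -[V VP]; have [i _ iV] := set_mem VP.
    by exists i; apply: val_inj.
  have B0C : cle B0 (cf B * P)%type.
    rewrite cfE; apply: (@cle_inj _ _ (fun b => (inr b, j0 0%N))) => b b' [].
    exact.
  have PC : cle P (cf B * P)%type by apply: (@cle_inj _ _ (fun p => (i0 0%N, p))) => p p' [].
  exact: (infinite_mul C0 (infinite_mul C0 B0C C0) PC).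
split=> [_ [i _ <-]|f U]; first exact: open_interior.
move=> /nbhs_tauP[A' [e [BA' e0 fU]]].
have [A BA AA'] := B0P _ BA'.
(* From [f] to the representative and on to [g] costs less than [3 * r + 4 * r], and [r < e / 8]. *)
have e80 : 0 < e / 8 by rewrite divr_gt0.
have [k /(_ k (leqnn k)) ke] := harmonic_small e80.
have k0 : 0 < @harmonic R k := harmonic_gt0 k.
pose a := (exist _ A (mem_set BA) : B0, k); pose i : I := (a, code a f).
have hf : forall x, A x -> `|h i x - f x| < 3 * @harmonic R k.
  by apply: (codeP a); exact: (hP i f).
exists (W i).
  split; first by exists i.
  apply/nbhs_tauP; exists A, (@harmonic R k); split=> //; first exact: B0B.
  move=> g fg x Ax; have fgx : `|f x - g x| < @harmonic R k := fg x Ax.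
  rewrite [ltRHS](_ : _ = 4 * @harmonic R k)//; have -> : h i x - g x = (h i x - f x) + (f x - g x) by ring.
  apply: le_lt_trans (ler_normD _ _) _.
  by have := hf x Ax; lra.
move=> g /interior_subset Wg; apply: fU => x /AA' Ax.
have -> : f x - g x = (h i x - g x) - (h i x - f x) by ring.
apply: le_lt_trans (ler_normB _ _) _.
have hg : `|h i x - g x| < 4 * @harmonic R k := Wg x Ax.
by have := hf x Ax; lra.
Qed.

End upper_bound.

Theorem corollary3p12 (R : realType) (X : metricType R) (B : bornology X)
    (closedB : has_closed_base B) :
  [set: weight (Ctau R B)] #= [set: (cf B * cpowlt bool (born_delta B))%type].
Proof.
apply/card_eqPle; split; first exact: weight_le_cf_cpowlt.
apply: infinite_mul; last exact: cpowlt_le_weight.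
- by have [F _ ->] := weightP (Ctau R B); apply: (@cle_inj _ _ inl) => ? ? [].
- exact: cf_le_weight.
Qed.
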